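(* Let $(A,\circ)$ be a commutative associative algebra, and let $(A_h,\circ_h)$ be an associative deformation of it with quasiclassical limit Poisson algebra $(A,\{,\},\circ)$. Let $(V,\cdot,\rho_\circ)$ be an $A$-module algebra, and let $(V_h,\cdot_h,l_h,r_h)$ be an $A_h$-bimodule algebra deformation of it with quasiclassical limit the $(A,\{,\},\circ)$-module Poisson algebra $(V,[,],\cdot,\rho_{\{,\}},\rho_\circ)$. Let $\lambda\in\mathbf k$ and let $T\in\mathrm{Hom}_{\mathbf k}(V,A)$ be an $\mathcal O$-operator of weight $\lambda$ on $(A,\circ)$ associated to $(V,\cdot,\rho_\circ)$. If the scalar deformation $T_{\mathbf K}:V_h\to A_h$, $T_{\mathbf K}(\sum_{i\ge0} v_ih^i)=\sum_{i\ge 0}T(v_i)h^i$, is an $\mathcal O$-operator of weight $\lambda$ on $(A_h,\circ_h)$ associated to $(V_h,\cdot_h,l_h,r_h)$, then $T$ is an $\mathcal O$-operator of weight $\lambda$ on the Poisson algebra $(A,\{,\},\circ)$ associated to the $(A,\{,\},\circ)$-module Poisson algebra $(V,[,],\cdot,\rho_{\{,\}},\rho_\circ)$.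
   Context: Throughout, $\mathbf{k}$ is a field of characteristic $0$ and $\mathbf{K}=\mathbf{k}[[h]]$. For a vector space $V$, $V_h=V[[h]]$. A topologically free associative algebra is $(A_h,\circ_h)$ with $A_h=A[[h]]$ and $\circ_h$ a $\mathbf K$-bilinear associative product; it is an associative deformation of $(A,\circ)$ if $x\circ_h y\equiv x\circ y\pmod h$ for $x,y\in A$. If $(A,\circ)$ is commutative, the quasiclassical limit (QCL) is the Poisson algebra $(A,\{,\},\circ)$ with $\{x,y\}\equiv\frac{x\circ_hy-y\circ_hx}{h}\pmod h$. Bimodule algebras: for associative algebras $(A,\circ)$, $(V,\cdot)$ and linear maps $l,r:A\to\mathrm{End}(V)$, $(V,\cdot,l,r)$ is an $A$-bimodule algebra if $A\oplus V$ with $(x,u)\odot(y,v)=(x\circ y,\,l(x)v+r(y)u+u\cdot v)$ is an associative algebra, denoted $A\ltimes_{l,r}V$. If $(A,\circ),(V,\cdot)$ are commutative and $l=r=\rho_\circ$, then $(V,\cdot,\rho_\circ)$ is called an $A$-module algebra (so that $A\ltimes_{\rho_\circ} V$ is commutative associative). A topologically free $A_h$-bimodule algebra $(V_h,\cdot_h,l_h,r_h)$ is the same notion over $\mathbf K$ with topologically free algebras and $\mathbf K$-linear maps $l_h,r_h:A_h\to\mathrm{End}_{\mathbf K}(V_h)$. It is an $A_h$-bimodule algebra deformation of $(V,\cdot,l,r)$ if $A_h\ltimes_{l_h,r_h}V_h$ is an associative deformation of $A\ltimes_{l,r}V$ (identifying $A_h\oplus V_h$ with $(A\oplus V)_h$).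 For an $A$-module algebra $(V,\cdot,\rho_\circ)$ the QCL of such a deformation is $(V,[,],\cdot,\rho_{\{,\}},\rho_\circ)$, where $(V,[,],\cdot)$ is the QCL of $(V_h,\cdot_h)$ and $\rho_{\{,\}}(x)u\equiv\frac{l_h(x)u-r_h(x)u}{h}\pmod h$ for $x\in A,u\in V$. Poisson modules: for Poisson algebras $(P,\{,\},\circ)$, $(Q,[,],\cdot)$ and linear maps $\rho_{\{,\}},\rho_\circ:P\to\mathrm{End}(Q)$, $(Q,[,],\cdot,\rho_{\{,\}},\rho_\circ)$ is a $P$-module Poisson algebra if $P\oplus Q$ with $\llbracket(x,u),(y,v)\rrbracket=(\{x,y\},\rho_{\{,\}}(x)v-\rho_{\{,\}}(y)u+[u,v])$ and $(x,u)\odot(y,v)=(x\circ y,\rho_\circ(x)v+\rho_\circ(y)u+u\cdot v)$ is a Poisson algebra. It is known (within the same theory) that the QCL of a bimodule algebra deformation of a module algebra is an $(A,\{,\},\circ)$-module Poisson algebra. $\mathcal O$-operators: an $\mathcal O$-operator of weight $\lambda$ on an associative algebra $(A,\circ)$ associated to an $A$-bimodule algebra $(V,\cdot,l,r)$ is a linear map $T:V\to A$ with $T(u)\circ T(v)=T(l(T(u))v)+T(r(T(v))u)+\lambda T(u\cdot v)$ (with $l=r=\rho_\circ$ for a module algebra; $\mathbf K$-linear in the topologically free case). An $\mathcal O$-operator of weight $\lambda$ on a Poisson algebra $(P,\{,\},\circ)$ associated to a $P$-module Poisson algebra $(Q,[,],\cdot,\rho_{\{,\}},\rho_\circ)$ is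 a linear map $T:Q\to P$ with $\{T(u),T(v)\}=T(\rho_{\{,\}}(T(u))v)-T(\rho_{\{,\}}(T(v))u)+\lambda T([u,v])$ and $T(u)\circ T(v)=T(\rho_\circ(T(u))v)+T(\rho_\circ(T(v))u)+\lambda T(u\cdot v)$ for all $u,v\in Q$. *)

(* Defs.v *)
From HB Require Import structures.
From mathcomp Require Import all_boot all_algebra.
From mathcomp Require Import boolp.

Set Implicit Arguments.
Unset Strict Implicit.
Unset Printing Implicit Defensive.

Import GRing.Theory.

Local Open Scope ring_scope.

(* [fps V] is V[[h]], a series being the sequence of its coefficients. The     *)
(* product of k[[h]] and its action on V[[h]] are Cauchy products, unlike the  *)
(* pointwise ones that MathComp-Analysis puts on the function type [nat -> V]. *)
Definition fps (V : Type) : Type := nat -> V.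

HB.instance Definition _ (V : Type) := gen_eqMixin (fps V).
HB.instance Definition _ (V : Type) := gen_choiceMixin (fps V).

Section FpsZmodule.
Variable V : zmodType.
Implicit Types u v w : fps V.

Definition fps_add u v : fps V := fun n => u n + v n.
Definition fps_opp u : fps V := fun n => - u n.
Definition fps_zero : fps V := fun=> 0.

Lemma fps_addA : associative fps_add.
Proof. by move=> u v w; apply/funext => n; rewrite /fps_add addrA. Qed.

Lemma fps_addC : commutative fps_add.
Proof. by move=> u v; apply/funext => n; rewrite /fps_add addrC. Qed.

Lemma fps_add0 : left_id fps_zero fps_add.
Proof. by move=> u; apply/funext => n; rewrite /fps_add add0r. Qed.

Lemma fps_addN : left_inverse fps_zero fps_opp fps_add.
Proof. by move=> u; apply/funext => n; rewrite /fps_add addNr. Qed.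

HB.instance Definition _ :=
  GRing.isZmodule.Build (fps V) fps_addA fps_addC fps_add0 fps_addN.

End FpsZmodule.

Definition fpsC (V : zmodType) (v : V) : fps V :=
  fun n => if n == 0 then v else 0.

Definition fps_map (U V : Type) (f : U -> V) (u : fps U) : fps V :=
  fun n => f (u n).

Definition fps_scale (R : pzRingType) (V : lmodType R) (a : fps R) (v : fps V)
  : fps V := fun n => \sum_(i < n.+1) a i *: v (n - i)%N.

Definition fps_mul (R : pzRingType) (a b : fps R) : fps R :=
  fun n => \sum_(i < n.+1) a i * b (n - i)%N.

Section FpsScaleTheory.
Variables (R : pzRingType) (V : lmodType R).
Implicit Types (a b : fps R) (v w : fps V).

Lemma fps_scaleA a b v :
  fps_scale a (fps_scale b v) = fps_scale (fps_mul a b) v.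
Proof.
apply/funext => n; rewrite /fps_scale /fps_mul.
pose F i m := (a i * b (m - i)%N) *: v (n - m)%N.
transitivity (\sum_(0 <= i < n.+1) \sum_(0 <= m < n.+1 | (i <= m)%N) F i m).
  rewrite big_mkord; apply: eq_bigr => i _.
  have le_i_n : (i <= n)%N by rewrite -ltnS.
  rewrite -(big_nat_widenl _ 0 _ xpredT) //.
  transitivity (\sum_(0 + i <= m < n.+1) F i m); last by rewrite add0n.
  rewrite scaler_sumr big_addn subSn // big_mkord.
  by apply: eq_bigr => j _; rewrite /F addnK scalerA addnC subnDA.
rewrite (exchange_big_dep_nat xpredT) //= big_mkord; apply: eq_bigr => m _.
rewrite scaler_suml big_mkord.
by rewrite (big_ord_widen n.+1 (F^~ m)) //; apply: eq_bigl => i; rewrite ltnS.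
Qed.

Lemma fps_scale1 v : fps_scale (fpsC 1) v = v.
Proof.
apply/funext => n; rewrite /fps_scale big_ord_recl /= scale1r subn0 big1 ?addr0//.
by move=> i _; rewrite scale0r.
Qed.

Lemma fps_scaleDr a : {morph @fps_scale R V a : v w / v + w}.
Proof.
move=> v w; apply/funext => n.
rewrite [RHS]/GRing.add /= /fps_add /fps_scale -big_split.
by apply: eq_bigr => i _; rewrite scalerDr.
Qed.

Lemma fps_scaleDl v : {morph (@fps_scale R V)^~ v : a b / a + b}.
Proof.
move=> a b; apply/funext => n.
rewrite [RHS]/GRing.add /= /fps_add /fps_scale -big_split.
by apply: eq_bigr => i _; rewrite scalerDl.
Qed.

End FpsScaleTheory.

Section FpsRing.
Variable R : comNzRingType.
Implicit Types a b c : fps R.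

Lemma fps_mulC : commutative (@fps_mul R).
Proof.
move=> a b; apply/funext => n; rewrite /fps_mul (reindex_inj rev_ord_inj) /=.
by apply: eq_bigr => i _; rewrite subSS subKn ?leq_ord // mulrC.
Qed.

Lemma fps_mulA : associative (@fps_mul R).
Proof. move=> a b c; exact: (@fps_scaleA R R^o). Qed.

Lemma fps_mul1 : left_id (fpsC 1) (@fps_mul R).
Proof. exact: (@fps_scale1 R R^o). Qed.

Lemma fps_mulDl : left_distributive (@fps_mul R) +%R.
Proof. move=> a b c; exact: (@fps_scaleDl R R^o). Qed.

Lemma fps1_neq0 : fpsC 1 != 0 :> fps R.
Proof.
apply/eqP => /(congr1 (fun a : fps R => a 0%N)) /eqP.
by rewrite /= oner_eq0.
Qed.

HB.instance Definition _ := GRing.Zmodule_isComNzRing.Build (fps R)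
  fps_mulA fps_mulC fps_mul1 fps_mulDl fps1_neq0.

HB.instance Definition _ (V : lmodType R) :=
  GRing.Zmodule_isLmodule.Build (fps R) (fps V)
    (@fps_scaleA R V) (@fps_scale1 R V) (@fps_scaleDr R V) (@fps_scaleDl R V).

Definition fpsX : fps R := fun n => (n == 1)%:R.

Definition eqmodh (V : lmodType R) (u v : fps V) : Prop :=
  exists w : fps V, u - v = fpsX *: w.

Section Coefficients.
Variable V : lmodType R.
Implicit Types u v w : fps V.

Lemma fpsD_coef u v n : (u + v) n = u n + v n. Proof. by []. Qed.

Lemma fpsN_coef u n : (- u) n = - u n. Proof. by []. Qed.

Lemma fpsZ_coef a u n : (a *: u) n = \sum_(i < n.+1) a i *: u (n - i)%N.
Proof. by []. Qed.

Lemma fpsXZ_coef w n : (fpsX *: w) n = if n is n'.+1 then w n' else 0.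
Proof.
rewrite fpsZ_coef big_ord_recl scale0r add0r.
case: n => [|n]; first by rewrite big_ord0.
rewrite big_ord_recl /= scale1r subSS subn0 big1 ?addr0 // => i _.
exact: scale0r.
Qed.

Lemma eqmodhP u v : eqmodh u v <-> u 0%N = v 0%N.
Proof.
split=> [[w uv]|uv].
  apply/eqP; rewrite -subr_eq0; apply/eqP.
  by rewrite -fpsN_coef -fpsD_coef uv fpsXZ_coef.
exists (fun n => (u - v) n.+1); apply/funext => -[|n]; rewrite fpsXZ_coef //.
by rewrite fpsD_coef fpsN_coef uv subrr.
Qed.

End Coefficients.
End FpsRing.

Section Pairing.
Variables A V : Type.

Definition fps_pair (s : fps A * fps V) : fps (A * V) :=
  fun n => (s.1 n, s.2 n).

Definition fps_unpair (s : fps (A * V)) : fps A * fps V :=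
  (fps_map fst s, fps_map snd s).

Lemma fps_pairK : cancel fps_pair fps_unpair.
Proof. by case. Qed.

Lemma fps_unpairK : cancel fps_unpair fps_pair.
Proof. by move=> s; apply/funext => n; rewrite /fps_pair /= -surjective_pairing. Qed.

End Pairing.

Lemma fps_pair_linear (R : comNzRingType) (A V : lmodType R) :
  linear (@fps_pair A V).
Proof.
move=> a s t; apply/funext => n; rewrite fpsD_coef /fps_pair /= !fpsD_coef.
have sumE (F : nat -> A * V) :
    \sum_(i < n.+1) F i = (\sum_(i < n.+1) (F i).1, \sum_(i < n.+1) (F i).2).
  elim: n.+1 => [|m IHm]; first by rewrite !big_ord0.
  by rewrite !big_ord_recr /= IHm.
by rewrite !fpsZ_coef (sumE (fun i => a i *: (s.1 (n - i)%N, s.2 (n - i)%N))).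
Qed.

(* Algebras need not be unital, so a product is an arbitrary bilinear map on   *)
(* a module rather than an instance of [algType].                              *)
Section Algebras.
Variable R : comNzRingType.

Definition bilinear_map (U V W : lmodType R) (f : U -> V -> W) : Prop :=
  (forall v, linear (f^~ v)) /\ (forall u, linear (f u)).

Definition assoc_algebra (A : lmodType R) (m : A -> A -> A) : Prop :=
  bilinear_map m /\ associative m.

Definition comm_assoc_algebra (A : lmodType R) (m : A -> A -> A) : Prop :=
  assoc_algebra m /\ commutative m.

Definition lie_algebra (A : lmodType R) (br : A -> A -> A) : Prop :=
  [/\ bilinear_map br, (forall x, br x x = 0)
    & forall x y z, br x (br y z) + br y (br z x) + br z (br x y) = 0].

Definition poisson_algebra (A : lmodType R) (br m : A -> A -> A) : Prop :=
  [/\ lie_algebra br, comm_assoc_algebra m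
    & forall x y z, br x (m y z) = m (br x y) z + m y (br x z)].

Section Semidirect.
Variables A V : lmodType R.

Definition semidirect (m : A -> A -> A) (mV : V -> V -> V) (l r : A -> V -> V)
    (s t : A * V) : A * V :=
  (m s.1 t.1, l s.1 t.2 + r t.1 s.2 + mV s.2 t.2).

Definition bimodule_algebra (m : A -> A -> A) (mV : V -> V -> V)
    (l r : A -> V -> V) : Prop :=
  [/\ assoc_algebra m, assoc_algebra mV, bilinear_map l, bilinear_map r
    & assoc_algebra (semidirect m mV l r)].

Definition module_algebra (m : A -> A -> A) (mV : V -> V -> V)
    (rho : A -> V -> V) : Prop :=
  [/\ commutative m, commutative mV & bimodule_algebra m mV rho rho].

Definition semidirect_bracket (br : A -> A -> A) (brV : V -> V -> V)
    (rho : A -> V -> V) (s t : A * V) : A * V :=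
  (br s.1 t.1, rho s.1 t.2 - rho t.1 s.2 + brV s.2 t.2).

Definition module_poisson_algebra (br m : A -> A -> A) (brV mV : V -> V -> V)
    (rhob rhom : A -> V -> V) : Prop :=
  [/\ poisson_algebra br m, poisson_algebra brV mV,
      bilinear_map rhob, bilinear_map rhom
    & poisson_algebra (semidirect_bracket br brV rhob)
        (semidirect m mV rhom rhom)].

Definition O_operator (lam : R) (m : A -> A -> A) (mV : V -> V -> V)
    (l r : A -> V -> V) (T : V -> A) : Prop :=
  [/\ bimodule_algebra m mV l r, linear T
    & forall u v,
        m (T u) (T v) = T (l (T u) v) + T (r (T v) u) + lam *: T (mV u v)].

Definition poisson_O_operator (lam : R) (br m : A -> A -> A)
    (brV mV : V -> V -> V) (rhob rhom : A -> V -> V) (T : V -> A) : Prop :=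
  [/\ module_poisson_algebra br m brV mV rhob rhom, linear T,
      forall u v,
        br (T u) (T v)
        = T (rhob (T u) v) - T (rhob (T v) u) + lam *: T (brV u v)
    & forall u v,
        m (T u) (T v)
        = T (rhom (T u) v) + T (rhom (T v) u) + lam *: T (mV u v)].

End Semidirect.
End Algebras.

Section Deformations.
Variable k : fieldType.

Definition assoc_deformation (A : lmodType k) (m : A -> A -> A)
    (mh : fps A -> fps A -> fps A) : Prop :=
  assoc_algebra mh
  /\ forall x y, eqmodh (mh (fpsC x) (fpsC y)) (fpsC (m x y)).

(* The series [w] is (x o_h y - y o_h x)/h; it is unique, as V[[h]] has no     *)
(* h-torsion.                                                                  *)
Definition is_qcl (A : lmodType k) (mh : fps A -> fps A -> fps A)
    (br : A -> A -> A) : Prop :=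
  forall x y, exists2 w : fps A,
    mh (fpsC x) (fpsC y) - mh (fpsC y) (fpsC x) = fpsX k *: w
    & eqmodh (fpsC (br x y)) w.

Variables A V : lmodType k.

Definition semidirect_fps (mh : fps A -> fps A -> fps A)
    (mVh : fps V -> fps V -> fps V) (lh rh : fps A -> fps V -> fps V)
    (s t : fps (A * V)) : fps (A * V) :=
  fps_pair (semidirect mh mVh lh rh (fps_unpair s) (fps_unpair t)).

Definition bimodule_deformation (m : A -> A -> A) (mV : V -> V -> V)
    (l r : A -> V -> V) (mh : fps A -> fps A -> fps A)
    (mVh : fps V -> fps V -> fps V) (lh rh : fps A -> fps V -> fps V) : Prop :=
  bimodule_algebra mh mVh lh rh
  /\ assoc_deformation (semidirect m mV l r) (semidirect_fps mh mVh lh rh).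

Definition is_bimodule_qcl (mVh : fps V -> fps V -> fps V)
    (lh rh : fps A -> fps V -> fps V) (brV : V -> V -> V)
    (rhob : A -> V -> V) : Prop :=
  is_qcl mVh brV
  /\ forall x u, exists2 w : fps V,
       lh (fpsC x) (fpsC u) - rh (fpsC x) (fpsC u) = fpsX k *: w
       & eqmodh (fpsC (rhob x u)) w.

End Deformations.

(* Main.v *)
Require Import Defs.
From mathcomp Require Import all_boot all_algebra.
From mathcomp Require Import boolp.

(** Every quasiclassical limit is a coefficient of a commutator: {x, y} is the
    coefficient of h in [x, y]_h, and rho_{,}(x) u that of l_h(x) u - r_h(x) u.
    If a K-bilinear product reduces mod h to a commutative one, the coefficient
    of h in [a, b]_h depends only on the constant terms of a and b; hence the
    coefficient of h^2 in [x, [y, z]_h]_h is {x, {y, z}}, and the Jacobi and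
    Leibniz rules follow from associativity. The Poisson O-operator identity is
    the coefficient of h in the antisymmetrised identity for T_K. *)

Set Implicit Arguments.
Unset Strict Implicit.
Unset Printing Implicit Defensive.

Import GRing.Theory.

Local Open Scope ring_scope.

(** * Arithmetic of bilinear maps *)

Section BilinearMaps.
Variables (R : comNzRingType) (U V W : lmodType R) (f : U -> V -> W).
Hypothesis fbil : bilinear_map f.

Lemma bilinDl v u u' : f (u + u') v = f u v + f u' v.
Proof. by have := fbil.1 v 1 u u'; rewrite !scale1r. Qed.

Lemma bilinDr u v v' : f u (v + v') = f u v + f u v'.
Proof. by have := fbil.2 u 1 v v'; rewrite !scale1r. Qed.

Lemma bilin0l v : f 0 v = 0.
Proof. by apply: (addrI (f 0 v)); rewrite -bilinDl !addr0. Qed.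

Lemma bilin0r u : f u 0 = 0.
Proof. by apply: (addrI (f u 0)); rewrite -bilinDr !addr0. Qed.

Lemma bilinZl a u v : f (a *: u) v = a *: f u v.
Proof. by have := fbil.1 v a u 0; rewrite /= bilin0l !addr0. Qed.

Lemma bilinZr a u v : f u (a *: v) = a *: f u v.
Proof. by have := fbil.2 u a v 0; rewrite /= bilin0r !addr0. Qed.

Lemma bilinBl v u u' : f (u - u') v = f u v - f u' v.
Proof. by rewrite bilinDl -scaleN1r bilinZl scaleN1r. Qed.

Lemma bilinBr u v v' : f u (v - v') = f u v - f u v'.
Proof. by rewrite bilinDr -scaleN1r bilinZr scaleN1r. Qed.

End BilinearMaps.

Lemma bilinear_sub (R : comNzRingType) (U V W : lmodType R)
    (f g : U -> V -> W) :
  bilinear_map f -> bilinear_map g -> bilinear_map (fun u v => f u v - g u v).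
Proof.
move=> fbil gbil; split=> [v|u] a x y /=.
  by rewrite (fbil.1 v) (gbil.1 v) /= scalerBr opprD addrACA.
by rewrite (fbil.2 u) (gbil.2 u) /= scalerBr opprD addrACA.
Qed.

Lemma bilinear_flip (R : comNzRingType) (U V W : lmodType R)
    (f : U -> V -> W) : bilinear_map f -> bilinear_map (fun v u => f u v).
Proof. by case. Qed.

(** * Commutators in an associative algebra *)

Section Commutator.
Variables (R : comNzRingType) (A : lmodType R).

Definition commutator (m : A -> A -> A) (x y : A) : A := m x y - m y x.

Lemma commutator_bilinear m : bilinear_map m -> bilinear_map (commutator m).
Proof. by move=> mbil; apply/bilinear_sub/bilinear_flip. Qed.

Lemma commutator_jacobi m (c := commutator m) x y z : assoc_algebra m ->
  c x (c y z) + c y (c z x) + c z (c x y) = 0.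
Proof.
case=> mbil mA; rewrite /c /commutator !(bilinBl mbil, bilinBr mbil) !mA !opprB.
(* Each double commutator contributes four signed triple products; the permutation puts each of the
   twelve next to its opposite. *)
rewrite [LHS](AC ((2*2)*(2*2)*(2*2)) (1*12*(2*7)*(3*10)*(4*5)*(6*11)*(8*9)))%AC.
by rewrite /= !subrr !addNr !addr0.
Qed.

Lemma commutator_leibniz m (c := commutator m) x y z : assoc_algebra m ->
  c x (m y z) = m (c x y) z + m y (c x z).
Proof.
case=> mbil mA; rewrite /c /commutator (bilinBl mbil) (bilinBr mbil) !mA.
by rewrite addrA subrK.
Qed.

End Commutator.

(** * Low coefficients of series and of K-bilinear maps *)

Section PowerSeries.
Variable k : fieldType.
Implicit Types V W : lmodType k.

Lemma fpsCZ_coef V (a : k) (w : fps V) n : (fpsC a *: w) n = a *: w n.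
Proof.
rewrite fpsZ_coef big_ord_recl /= subn0 big1 ?addr0 // => i _.
exact: scale0r.
Qed.

Lemma fpsC_linear V a (u v : V) : fpsC (a *: u + v) = fpsC a *: fpsC u + fpsC v.
Proof.
apply/funext => n; rewrite fpsD_coef fpsCZ_coef /fpsC.
by case: (n == 0%N); rewrite // scaler0 addr0.
Qed.

Lemma fpsC0 V : fpsC (0 : V) = 0.
Proof. by apply/funext => n; rewrite /fpsC if_same. Qed.

(** K-bilinearity controls only finite sums, so series are expanded by splitting off one constant
    term and a factor h. *)
Lemma fps_head_tail V (u : fps V) :
  u = fpsC (u 0%N) + fpsX k *: ((fun n => u n.+1) : fps V).
Proof.
apply/funext => n; rewrite fpsD_coef fpsXZ_coef /fpsC.
by case: n => [|n]; rewrite /= ?addr0 ?add0r.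
Qed.

Section BilinearCoefficients.
Variables (U V W : lmodType k) (f : fps U -> fps V -> fps W).
Hypothesis fbil : bilinear_map f.

(** Gives the k-bilinearity of the limit brackets, which are known only as coefficients. *)
Lemma bilinear_coef n : bilinear_map (fun x y => f (fpsC x) (fpsC y) n).
Proof.
split=> [v|u] a x y /=.
  by rewrite fpsC_linear (bilinDl fbil) (bilinZl fbil) fpsD_coef fpsCZ_coef.
by rewrite fpsC_linear (bilinDr fbil) (bilinZr fbil) fpsD_coef fpsCZ_coef.
Qed.

Lemma bilinear_coef0 u v : f u v 0%N = f (fpsC (u 0%N)) (fpsC (v 0%N)) 0%N.
Proof.
rewrite {1}(fps_head_tail u) {1}(fps_head_tail v).
rewrite (bilinDl fbil) !(bilinDr fbil) !(bilinZl fbil) !(bilinZr fbil).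
by rewrite !fpsD_coef !fpsXZ_coef !addr0.
Qed.

(** With u = u0 + h u' and v = v0 + h v', the term in h^2 cannot contribute, and the two terms in h
    contribute only their constant coefficients. *)
Lemma bilinear_coef1 u v :
  f u v 1%N = f (fpsC (u 0%N)) (fpsC (v 0%N)) 1%N
    + f (fpsC (u 0%N)) (fpsC (v 1%N)) 0%N + f (fpsC (u 1%N)) (fpsC (v 0%N)) 0%N.
Proof.
rewrite {1}(fps_head_tail u) {1}(fps_head_tail v).
rewrite (bilinDl fbil) !(bilinDr fbil) !(bilinZl fbil) !(bilinZr fbil).
rewrite !fpsD_coef !fpsXZ_coef addr0 bilinear_coef0.
by rewrite [f _ (fpsC (v 0%N)) 0%N]bilinear_coef0.
Qed.

End BilinearCoefficients.

(** * The quasiclassical limit of one commutative algebra *)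

Section QuasiclassicalLimit.
Variables (A : lmodType k) (m : A -> A -> A) (mh : fps A -> fps A -> fps A).
Variable br : A -> A -> A.
Hypotheses (mC : comm_assoc_algebra m) (mhD : assoc_deformation m mh).
Hypothesis brP : is_qcl mh br.

Let mhbil : bilinear_map mh := mhD.1.1.
Let cbil : bilinear_map (commutator mh) := commutator_bilinear mhbil.
Let mbil : bilinear_map m := mC.1.1.

Lemma deformation_coef0 u v : mh u v 0%N = m (u 0%N) (v 0%N).
Proof. by rewrite (bilinear_coef0 mhbil); have /eqmodhP := mhD.2 (u 0%N) (v 0%N). Qed.

(** Meant for [u] a commutator, which vanishes mod h: the product is then the undeformed one at
    order h. *)
Lemma deformation_coef1l u v :
  u 0%N = 0 -> mh u v 1%N = m (u 1%N) (v 0%N).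
Proof.
move=> u0; rewrite (bilinear_coef1 mhbil) u0 fpsC0 !(bilin0l mhbil) !add0r.
by rewrite deformation_coef0.
Qed.

Lemma deformation_coef1r u v :
  v 0%N = 0 -> mh u v 1%N = m (u 0%N) (v 1%N).
Proof.
move=> v0; rewrite (bilinear_coef1 mhbil) v0 fpsC0 !(bilin0r mhbil) add0r addr0.
by rewrite deformation_coef0.
Qed.

Lemma qcl_coef1 x y : br x y = commutator mh (fpsC x) (fpsC y) 1%N.
Proof.
have [w cE /eqmodhP brE] := brP x y.
by rewrite /commutator cE fpsXZ_coef -brE.
Qed.

Lemma commutator_coef0 u v : commutator mh u v 0%N = 0.
Proof. by rewrite /commutator fpsD_coef fpsN_coef !deformation_coef0 mC.2 subrr. Qed.

Lemma commutator_coef1 u v : commutator mh u v 1%N = br (u 0%N) (v 0%N).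
Proof. by rewrite (bilinear_coef1 cbil) !commutator_coef0 !addr0 -qcl_coef1. Qed.

(** The inner commutator is h times a series with constant term [br y z]; h factors out, leaving a
    coefficient of h in the outer one. *)
Lemma double_commutator_coef2 x y z :
  commutator mh (fpsC x) (commutator mh (fpsC y) (fpsC z)) 2%N
  = br x (br y z).
Proof.
rewrite (fps_head_tail (commutator mh (fpsC y) _)) commutator_coef0 fpsC0 add0r.
by rewrite (bilinZr cbil) fpsXZ_coef commutator_coef1 -qcl_coef1.
Qed.

Lemma qcl_poisson : poisson_algebra br m.
Proof.
have brE : br = fun x y => commutator mh (fpsC x) (fpsC y) 1%N.
  by apply/funext => x; apply/funext => y; apply: qcl_coef1.
split=> // [|x y z].
  split=> [|x|x y z].
  - by rewrite brE; apply: bilinear_coef cbil _.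
  - by rewrite qcl_coef1 /commutator subrr.
  (* The Jacobi identity of the commutator is read off at h^2. *)
  - rewrite -!double_commutator_coef2 -!fpsD_coef.
    by rewrite (commutator_jacobi _ _ _ mhD.1).
(* The Leibniz rule of the commutator is read off at h, where both products on its right have a
   factor divisible by h. *)
have := congr1 (fun s : fps A => s 1%N)
  (commutator_leibniz (fpsC x) (fpsC y) (fpsC z) mhD.1).
rewrite commutator_coef1 deformation_coef0 fpsD_coef.
rewrite deformation_coef1l ?deformation_coef1r ?commutator_coef0 //.
by rewrite !commutator_coef1.
Qed.

End QuasiclassicalLimit.

(** * The quasiclassical limit of a bimodule algebra *)

Section BimoduleLimit.
Variables (A V : lmodType k) (m : A -> A -> A) (mV : V -> V -> V).
Variables (rho : A -> V -> V) (mh : fps A -> fps A -> fps A).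
Variables (mVh : fps V -> fps V -> fps V) (lh rh : fps A -> fps V -> fps V).
Variables (br : A -> A -> A) (brV : V -> V -> V) (rhob : A -> V -> V).
Hypotheses (mhD : assoc_deformation m mh) (brP : is_qcl mh br).
Hypothesis mVP : module_algebra m mV rho.
Hypothesis mVhD : bimodule_deformation m mV rho rho mh mVh lh rh.
Hypothesis brVP : is_bimodule_qcl mVh lh rh brV rhob.

Lemma bimodule_qcl_coef1 x u :
  rhob x u = (lh (fpsC x) (fpsC u) - rh (fpsC x) (fpsC u)) 1%N.
Proof.
have [w lrE /eqmodhP rhobE] := brVP.2 x u.
by rewrite lrE fpsXZ_coef -rhobE.
Qed.

Lemma fps_unpairC (s : A * V) : fps_unpair (fpsC s) = (fpsC s.1, fpsC s.2).
Proof.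
by congr pair; apply/funext => n; rewrite /fps_map /fpsC; case: (n == 0%N).
Qed.

(** The reduction mod h is assumed on the semidirect product; restricting it to pairs with zero
    first component isolates the product of V. *)
Lemma bimodule_deformation_base : assoc_deformation mV mVh.
Proof.
have [[_ mVhA lhbil rhbil _] [_ sdh]] := mVhD.
split=> // u v; apply/eqmodhP.
have /eqmodhP := sdh (0, u) (0, v).
rewrite /semidirect_fps !fps_unpairC /fps_pair /semidirect /= fpsC0.
rewrite (bilin0l lhbil) (bilin0l rhbil) !add0r /fpsC /= => -[_ ->].
have [_ _ [_ _ rhobil _ _]] := mVP.
by rewrite !(bilin0l rhobil) !add0r.
Qed.

Lemma semidirect_comm_assoc :
  comm_assoc_algebra (semidirect m mV rho rho).
Proof.
have [mC mVC [_ _ _ _ sdA]] := mVP.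
split=> // -[x u] [y v]; rewrite /semidirect /= mC mVC.
by rewrite [rho x v + _]addrC.
Qed.

(** Reduces the module Poisson axioms to [qcl_poisson], applied to the semidirect product itself. *)
Lemma semidirect_qcl :
  is_qcl (semidirect_fps mh mVh lh rh) (semidirect_bracket br brV rhob).
Proof.
move=> [x u] [y v]; set c := _ - _.
have c_coef n : c n = (commutator mh (fpsC x) (fpsC y) n,
    (lh (fpsC x) (fpsC v) - rh (fpsC x) (fpsC v)) n
    - (lh (fpsC y) (fpsC u) - rh (fpsC y) (fpsC u)) n
    + commutator mVh (fpsC u) (fpsC v) n).
  rewrite /c fpsD_coef fpsN_coef /semidirect_fps !fps_unpairC /fps_pair.
  congr pair; rewrite /= !fpsD_coef !fpsN_coef !opprD opprK.
  (* The actions are regrouped into l_h - r_h at x on v and at y on u, beside the commutator of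
     V. *)
  by rewrite [LHS](AC (3*3) (1*5*(4*2)*(3*6)))%AC.
have c0 : c 0%N = 0.
  have [w1 E1 _] := brP x y; have [w2 E2 _] := brVP.1 u v.
  have [w3 E3 _] := brVP.2 x v; have [w4 E4 _] := brVP.2 y u.
  by rewrite c_coef /commutator E1 E2 E3 E4 !fpsXZ_coef subrr addr0.
(* The shifted series is c/h, since c has no constant term. *)
exists (fun n => c n.+1).
  by rewrite [LHS]fps_head_tail c0 fpsC0 add0r.
apply/eqmodhP; rewrite c_coef /semidirect_bracket /fpsC /=.
by rewrite (qcl_coef1 brP) (qcl_coef1 brVP.1) !bimodule_qcl_coef1.
Qed.

Lemma bimodule_qcl_poisson : module_poisson_algebra br m brV mV rhob rho.
Proof.
have [mC mVC [mA mVA rhobil _ _]] := mVP.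
have [[_ _ lhbil rhbil _] sdD] := mVhD.
split=> //.
- exact: qcl_poisson brP.
- exact: qcl_poisson bimodule_deformation_base brVP.1.
- rewrite (_ : rhob = fun x u => (lh (fpsC x) (fpsC u)
    - rh (fpsC x) (fpsC u)) 1%N); last first.
    by apply/funext => x; apply/funext => u; apply: bimodule_qcl_coef1.
  exact: bilinear_coef (bilinear_sub lhbil rhbil) _.
- exact: qcl_poisson semidirect_comm_assoc sdD semidirect_qcl.
Qed.

End BimoduleLimit.
End PowerSeries.

(** * Descent of the O-operator to the limit *)

Unset Implicit Arguments.

Theorem theorem2p21 (k : fieldType) (hk : [pchar k] =i pred0)
  (A : lmodType k) (mul : A -> A -> A)
  (mulh : fps A -> fps A -> fps A) (br : A -> A -> A)
  (hA : comm_assoc_algebra mul)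
  (hAh : assoc_deformation mul mulh)
  (hbr : is_qcl mulh br)
  (V : lmodType k) (mulV : V -> V -> V) (rho : A -> V -> V)
  (mulVh : fps V -> fps V -> fps V) (lh rh : fps A -> fps V -> fps V)
  (brV : V -> V -> V) (rhob : A -> V -> V)
  (hV : module_algebra mul mulV rho)
  (hVh : bimodule_deformation mul mulV rho rho mulh mulVh lh rh)
  (hbrV : is_bimodule_qcl mulVh lh rh brV rhob)
  (lam : k) (T : {linear V -> A})
  (hT : O_operator lam mul mulV rho rho T)
  (hTK : O_operator (fpsC lam) mulh mulVh lh rh (fps_map T)) :
  poisson_O_operator lam br mul brV mulV rhob rho T.
Proof.
have [_ Tlin TO] := hT; have [_ Tklin TkO] := hTK.
have fps_mapC x : fps_map T (fpsC x) = fpsC (T x).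
  by apply/funext => n; rewrite /fps_map /fpsC; case: (n == 0%N); rewrite ?raddf0.
split=> //; first exact: bimodule_qcl_poisson hAh hbr hV hVh hbrV.
(* The brackets become coefficients of h; the identity for T_K is applied to constant series in both
   orders, and [T] acts coefficientwise. *)
move=> u v; rewrite (qcl_coef1 hbr) (qcl_coef1 hbrV.1).
rewrite !(bimodule_qcl_coef1 hbrV) /commutator -!fps_mapC !TkO.
rewrite !(fpsD_coef, fpsN_coef, fpsCZ_coef) /fps_map !(raddfB T) scalerBr.
rewrite !opprD !opprK.
(* Pairing l_h with r_h at the same arguments produces the two [rhob] terms. *)
by rewrite [LHS](AC (3*3) (1*5*(4*2)*(3*6)))%AC.
Qed.
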